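(* Let $\lambda=(\lambda_1\ge\lambda_2\ge0)$, $\mu=(\mu_1\ge\mu_2\ge0)$, $\nu=(\nu_1\ge\nu_2\ge0)$ be partitions with at most two parts such that $|\lambda|+|\mu|+|\nu|\equiv0\pmod2$ and such that the triangle inequalities $|\mu|+|\nu|\ge|\lambda|$, $|\mu|+|\lambda|\ge|\nu|$, $|\lambda|+|\nu|\ge|\mu|$ hold. Then $N_{\mu,\nu,\lambda}>0$ if and only if all of the following linear inequalities hold: $$\lambda_1\le\mu_1+\nu_1,\quad \nu_1\le\lambda_1+\mu_1,\quad \mu_1\le\lambda_1+\nu_1;$$ $$\lambda_2\le\mu_1+\nu_2,\quad \nu_2\le\lambda_1+\mu_2,\quad \mu_2\le\lambda_1+\nu_2;$$ $$\lambda_2\le\mu_2+\nu_1,\quad \nu_2\le\lambda_2+\mu_1,\quad \mu_2\le\lambda_2+\nu_1;$$ $$\nu_1-\nu_2\le\mu_1+\mu_2+\lambda_1-\lambda_2,\quad \mu_1-\mu_2\le\lambda_1+\lambda_2+\nu_1-\nu_2,\quad \lambda_1-\lambda_2\le\nu_1+\nu_2+\mu_1-\mu_2,$$ $$\lambda_1-\lambda_2\le\mu_1+\mu_2+\nu_1-\nu_2,\quad \mu_1-\mu_2\le\nu_1+\nu_2+\lambda_1-\lambda_2,\quad \nu_1-\nu_2\le\lambda_1+\lambda_2+\mu_1-\mu_2.$$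
   Context: With $c_{\alpha,\beta}^{\mu}$ the Littlewood-Richardson coefficient ($s_\alpha s_\beta=\sum_\mu c_{\alpha,\beta}^\mu s_\mu$), the Newell-Littlewood number is $$N_{\mu,\nu,\lambda}=\sum_{\alpha,\beta,\gamma} c_{\alpha,\beta}^{\mu}c_{\alpha,\gamma}^{\nu}c_{\beta,\gamma}^{\lambda},$$ the sum over all triples of partitions (finitely many nonzero terms). $|\lambda|=\sum_i\lambda_i$. *)

(* Defs.v *)
From HB Require Import structures.
From mathcomp Require Export all_boot all_order all_algebra finmap mpoly.
From mathcomp Require Export boolp classical_sets fsbigop.

Set Implicit Arguments.
Unset Strict Implicit.
Unset Printing Implicit Defensive.

Import GRing.Theory.
Local Open Scope ring_scope.

(* An integer partition is the list of its positive parts, so that trailing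
   zeros are not recorded and the number of parts is the size of the list. *)
Definition is_intpart (s : seq nat) : bool := sorted geq s && (0%N \notin s).

Record intpart := IntPart { parts :> seq nat; _ : is_intpart parts }.
HB.instance Definition _ := [isSub for parts].
HB.instance Definition _ := [Choice of intpart by <:].

(* The parts lambda_1, lambda_2, ... are numbered from 1; lambda_i = 0 beyond
   the number of parts.  They are taken in int so that the differences
   lambda_1 - lambda_2 are genuine. *)
Definition part (lambda : intpart) (i : nat) : int := (nth 0%N lambda i.-1)%:Z.

Definition weight (lambda : intpart) : nat := sumn lambda.

Definition alternant (n : nat) (m : 'I_n -> nat) : {mpoly int[n]} :=
  \det (\matrix_(i, j) ('X_j ^+ m i)).

(* The Schur polynomial s_lambda(x_1, ..., x_n), by Cauchy's formula
     det (x_j ^ (lambda_i + n - i)) / det (x_j ^ (n - i)),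
   with i numbered from 0 below.  The quotient is a polynomial; it is written in
   the field of fractions.  When lambda has more than n parts,
   s_lambda(x_1, ..., x_n) = 0. *)
Definition schur (n : nat) (lambda : intpart) : {fraction {mpoly int[n]}} :=
  if (size lambda <= n)%N then
    tofrac (alternant (fun i : 'I_n => (nth 0 lambda i + (n - i.+1))%N))
    / tofrac (alternant (fun i : 'I_n => (n - i.+1)%N))
  else 0.

(* c is the expansion  s_alpha s_beta = \sum_mu c(mu) s_mu  in the ring of
   symmetric functions, where an identity amounts to the identities in n
   variables for all n. *)
Definition is_schur_expansion (alpha beta : intpart)
    (c : {fsfun intpart -> int with 0}) : Prop :=
  forall n : nat, schur n alpha * schur n beta
    = \sum_(mu <- finsupp c) (c mu)%:~R * schur n mu.

(* The Littlewood-Richardson coefficient c_{alpha, beta}^mu.  As the Schur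
   functions form a Z-basis of the symmetric functions, exactly one c satisfies
   is_schur_expansion alpha beta, and xget selects it. *)
Definition LR (alpha beta mu : intpart) : int :=
  xget [fsfun] [set c | is_schur_expansion alpha beta c]%classic mu.

(* The sum over all triples is a sum over a finite support: LR alpha beta mu
   vanishes unless weight alpha + weight beta = weight mu. *)
Definition newell_littlewood (mu nu lambda : intpart) : int :=
  \sum_(t \in [set: intpart * intpart * intpart]%classic)
    (let: (alpha, beta, gamma) := t in
     LR alpha beta mu * LR alpha gamma nu * LR beta gamma lambda).

(* Main.v *)
From HB Require Import structures.
Require Import Defs.
From mathcomp Require Import perm zify ring.

Set Implicit Arguments.
Unset Strict Implicit.
Unset Printing Implicit Defensive.

Import Order.TTheory GRing.Theory Num.Theory.
Local Open Scope ring_scope.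

(** Restricting to two variables kills every Schur function with more than two
    parts and keeps the others linearly independent.  Hence, when mu has at most
    two parts, the coefficient c_{alpha, beta}^mu can be read off the product of
    two-variable Schur polynomials: it vanishes unless alpha and beta have at
    most two parts, and the Clebsch-Gordan rule for GL_2 then says that it is 1
    if |alpha| + |beta| = |mu| and
      alpha_2 + beta_2 <= mu_2 <= min (alpha_1 + beta_2, alpha_2 + beta_1),
    and 0 otherwise ([LR_two_rows]).

    This reading presupposes that s_alpha s_beta does have an expansion with
    integer coefficients valid in any number n of variables
    ([schur_expansion_exists]).  For a fixed n, write A(m) for the alternant
    with exponents m and delta = (n - 1, ..., 1, 0).  Reducing powers of a
    variable modulo \prod_j (X - x_j) shows that A(delta) divides
    A(beta + delta); the quotient s_beta is symmetric, and A(m) s_beta is the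
    sum of the A(m + e) over the monomials x^e of s_beta, with their
    coefficients.  Each A(m + e) is zero or, after sorting, a signed
    A(lambda + delta).  This gives an expansion in n variables whose terms have
    weight at most |alpha| + |beta|, hence at most N = |alpha| + |beta| parts.
    Setting the last variable to zero turns an expansion in n + 1 variables
    into one in n variables, and expansions in N variables are unique, so all
    the expansions with n >= N agree.

    Consequently the Newell-Littlewood number counts triples
    (alpha, beta, gamma) subject to linear conditions.  The weights of alpha,
    beta and gamma are determined by those of mu, nu and lambda, which leaves
    the unknowns alpha_2, beta_2, gamma_2.  At every stage of a Fourier-Motzkin
    elimination the unknown has coefficient 1 in each of its lower bounds, so
    the elimination is exact over the integers; the conditions that it leaves
    follow from the stated inequalities ([newell_littlewood_feasible]), which
    are themselves linear consequences of the conditions on the triple. *)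

(** * Alternants *)

(** The exponent vector m as a monomial. *)
Definition mon n (m : 'I_n -> nat) : 'X_{1..n} := [multinom m i | i < n].

(** The antisymmetrization of f, the sum over all permutations of the variables
    of the signed images of f. *)
Definition antisym n (f : {mpoly int[n]}) : {mpoly int[n]} :=
  \sum_(s : 'S_n) (-1) ^+ s * msym s f.

Lemma alternant_antisym n (m : 'I_n -> nat) :
  alternant m = antisym 'X_[mon m].
Proof.
rewrite /alternant /determinant; apply: eq_bigr => s _; congr (_ * _).
rewrite mpolyXE_id rmorph_prod; apply: eq_bigr => i _.
by rewrite mxE mnmE rmorphXn /= /msym mmapX mmap1U.
Qed.

Lemma antisymM n (f p : {mpoly int[n]}) :
  p \is symmetric -> antisym (f * p) = antisym f * p.
Proof.
move=> /issymP sp; rewrite /antisym mulr_suml; apply: eq_bigr => s _.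
by rewrite msymM sp mulrA.
Qed.

Lemma antisym_sumZ n (I : Type) (r : seq I) (a : I -> int)
    (F : I -> {mpoly int[n]}) :
  antisym (\sum_(i <- r) a i *: F i) = \sum_(i <- r) a i *: antisym (F i).
Proof.
rewrite /antisym; under eq_bigr do rewrite raddf_sum mulr_sumr.
rewrite exchange_big; apply: eq_bigr => i _; rewrite scaler_sumr.
by apply: eq_bigr => s _; rewrite /= linearZ /= scalerAr.
Qed.

(** Since antisymmetrization commutes with multiplication by a symmetric p, the
    product is computed one monomial of p at a time. *)
Lemma alternantM n (m : 'I_n -> nat) (p : {mpoly int[n]}) :
  p \is symmetric ->
  alternant m * p
  = \sum_(e <- msupp p) p@_e *: alternant (fun i => (m i + e i)%N).
Proof.
move=> sp; rewrite alternant_antisym -antisymM // {1}[p]mpolyE mulr_sumr.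
under eq_bigr do rewrite -scalerAr -mpolyXD.
rewrite antisym_sumZ; apply: eq_bigr => e _; congr (_ *: _).
rewrite alternant_antisym; congr (antisym 'X_[_]).
by apply/mnmP => i; rewrite !mnmE.
Qed.

Lemma msym_alternant n (t : 'S_n) (m : 'I_n -> nat) :
  msym t (alternant m) = (-1) ^+ t * alternant m.
Proof.
rewrite alternant_antisym /antisym raddf_sum mulr_sumr /=.
rewrite [RHS](reindex_inj (mulIg t)); apply: eq_bigr => s _ /=.
rewrite msymM rmorphXn rmorphN1 msymMm odd_permM signr_addb.
by rewrite mulrA [_ * (_ * _)]mulrCA -signr_addb addbb mulr1.
Qed.

(** Strict decrease of an exponent vector. *)
Definition decreasing n (m : 'I_n -> nat) : Prop :=
  forall i j : 'I_n, (i < j)%N -> (m j < m i)%N.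

Lemma decreasing_inj n (m : 'I_n -> nat) : decreasing m -> injective m.
Proof.
move=> dm i j eqm; apply/val_inj; case: (ltngtP i j) => // /dm;
  by rewrite eqm ltnn.
Qed.

Lemma sorted_decreasing n (m : 'I_n -> nat) :
  decreasing m -> sorted gtn [seq m i | i <- enum 'I_n].
Proof.
move=> dm; apply: (homo_sorted (e := fun i j : 'I_n => (i < j)%N)).
  by move=> i j /dm.
by have := iota_ltn_sorted 0 n; rewrite -val_enum_ord sorted_map.
Qed.

(** Among the monomials of an alternant with strictly decreasing exponents m, only
    x^m itself has strictly decreasing exponents. *)
Lemma alternant_coeff n (m k : 'I_n -> nat) :
  decreasing m -> decreasing k ->
  (alternant m)@_(mon k) = [forall i, m i == k i]%:R.
Proof.
move=> dm dk; rewrite alternant_antisym /antisym raddf_sum /=.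
(* A permutation carrying one strictly decreasing vector to another is trivial:
   both vectors list the same values in decreasing order. *)
have key (s : 'S_n) : (forall i, m i = k (s i)) -> s = 1%g.
  move=> mks.
  have E : [seq m i | i <- enum 'I_n] = [seq k i | i <- enum 'I_n].
    apply: (sorted_eq (leT := gtn)).
    - by move=> a b c /= ? ?; lia.
    - by move=> a b /= ?; lia.
    - exact: sorted_decreasing.
    - exact: sorted_decreasing.
    rewrite (eq_map (g := k \o s)) // map_comp; apply: perm_map.
    apply: uniq_perm; rewrite ?(map_inj_uniq perm_inj) ?enum_uniq //.
    move=> i; rewrite mem_enum -{1}[i](permKV s) mem_map ?mem_enum //.
    exact: perm_inj.
  apply/permP => i; rewrite perm1; apply: (decreasing_inj dk).
  by rewrite -mks; apply: (eq_in_map _ _ _).2 E _ _; rewrite mem_enum.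
have coef s : (msym s 'X_[mon m])@_(mon k) = [forall i, m i == k (s i)]%:R :> int.
  rewrite mcoeff_sym mcoeffX; congr (nat_of_bool _)%:R.
  apply/eqP/forallP => [/mnmP e i|e].
    by have := e i; rewrite !mnmE => ->.
  by apply/mnmP => i; rewrite !mnmE (eqP (e i)).
rewrite (bigD1 (1%g : 'S_n)) //= odd_perm1 expr0 mul1r big1 ?addr0; last first.
  move=> s ns; rewrite mulr_sign.
  suff c0 : (msym s 'X_[int, mon m])@_(mon k) = 0.
    by case: ifP => _; rewrite ?mcoeffN c0 ?oppr0.
  rewrite coef; case: forallP => // e.
  by case/eqP: ns; apply: key => i; apply/eqP.
rewrite coef; congr (nat_of_bool _)%:R.
by apply: eq_forallb => i; rewrite perm1.
Qed.

Lemma alternant_perm n (s : 'S_n) (m : 'I_n -> nat) :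
  alternant (m \o s) = (-1) ^+ s * alternant m.
Proof.
rewrite /alternant -det_perm -det_mulmx -row_permE; congr (\det _).
by apply/matrixP => i j; rewrite !mxE.
Qed.

Lemma alternant_eq0 n (m : 'I_n -> nat) (i j : 'I_n) :
  i != j -> m i = m j -> alternant m = 0.
Proof.
move=> nij eqm; apply: (determinant_alternate nij) => k.
by rewrite !mxE eqm.
Qed.

Lemma eq_alternant n (m k : 'I_n -> nat) :
  m =1 k -> alternant m = alternant k.
Proof. by move=> e; congr (\det _); apply/matrixP => i j; rewrite !mxE e. Qed.

(** Modulo \prod_j (X - x_j), the power X^k is a combination of 1, ..., X^(n-1);
    evaluating at each x_j factors the matrix of the alternant through the
    Vandermonde matrix. *)
Lemma alternant_dvd n (m : 'I_n -> nat) :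
  exists p, alternant m = p * alternant (fun i : 'I_n => (n - i.+1)%N).
Proof.
pose d : {poly {mpoly int[n]}} := \prod_(j < n) ('X - ('X_j)%:P).
have md : d \is monic by apply: monic_prod_XsubC.
have sd : size d = n.+1 by rewrite size_prod_XsubC /index_enum -enumT size_enum_ord.
pose r k := Pdiv.Ring.rmodp 'X^k d.
have rE k (j : 'I_n) :
    'X_j ^+ k = \sum_(i < n) (r k)`_(n - i.+1) * 'X_j ^+ (n - i.+1).
  have := congr1 (fun p => p.[('X_j : {mpoly int[n]})])
    (Pdiv.RingMonic.rdivp_eq md 'X^k).
  rewrite hornerXn hornerD hornerM => ->.
  have /eqP-> : d.['X_j] == 0.
    rewrite /d horner_prod; apply/prodf_eq0; exists j => //.
    by rewrite hornerXsubC subrr.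
  rewrite mulr0 add0r (horner_coef_wide (n := n)); last first.
    by rewrite -ltnS -sd Pdiv.Ring.ltn_rmodpN0 // monic_neq0.
  by rewrite (reindex_inj rev_ord_inj).
exists (\det (\matrix_(i, l) (r (m i))`_(n - l.+1))).
rewrite /alternant -det_mulmx; congr (\det _).
by apply/matrixP => i j; rewrite !mxE rE; apply: eq_bigr => l _; rewrite !mxE.
Qed.

(** * Partitions and strictly decreasing exponents *)

Lemma geq_trans : transitive geq.
Proof. by move=> a b c /= ba ac; apply: leq_trans ac ba. Qed.

Lemma nth_sorted_geq (s : seq nat) i j :
  sorted geq s -> (i <= j)%N -> (nth 0 s j <= nth 0 s i)%N.
Proof.
move=> ss ij; have [js|sj] := ltnP j (size s); last by rewrite nth_default.
by apply: (sorted_leq_nth geq_trans leqnn 0%N ss) => //; apply: leq_ltn_trans js.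
Qed.

(** The zeros of a nonincreasing sequence are at its end, so that removing them
    does not move the other entries. *)
Lemma nth_filter_neq0 (s : seq nat) i :
  sorted geq s -> nth 0%N [seq x <- s | x != 0%N] i = nth 0%N s i.
Proof.
elim: s i => //= x s IHs i ps.
have ss := path_sorted ps.
case: eqP => [x0|_] /=; last by case: i => //= i; apply: IHs.
have s0 : all (pred1 0%N) s.
  have := order_path_min geq_trans ps.
  by apply: sub_all => y; rewrite /= x0 leqn0.
have -> : [seq x <- s | x != 0%N] = [::].
  apply/eqP; rewrite -[_ == _]negbK -has_filter -all_predC.
  by apply: sub_all s0 => y /= ->.
rewrite x0; case: i => [//|i] /=.
have [si|si] := ltnP i (size s); last by rewrite nth_default.
by have /eqP-> := all_nthP 0%N s0 i si.
Qed.

Lemma intpart_sorted (lambda : intpart) : sorted geq lambda.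
Proof. by case: lambda => s /= /andP[]. Qed.

Lemma intpart_gt0 (lambda : intpart) i :
  (0 < nth 0 lambda i)%N = (i < size lambda)%N.
Proof.
case: lambda => s /= /andP[_ s0]; have [si|si] := ltnP i (size s).
  by rewrite lt0n; apply: contra s0 => /eqP <-; apply: mem_nth.
by rewrite nth_default.
Qed.

Lemma intpart_inj (lambda mu : intpart) :
  (forall i, nth 0%N lambda i = nth 0%N mu i) -> lambda = mu.
Proof.
move=> e; apply/val_inj; apply: (@eq_from_nth _ 0%N) => //=.
have s i : (i < size lambda)%N = (i < size mu)%N by rewrite -!intpart_gt0 e.
apply/eqP; rewrite eqn_leq; apply/andP; split; rewrite leqNgt.
  by rewrite s ltnn.
by rewrite -s ltnn.
Qed.

Lemma weight_sum n (lambda : intpart) : (size lambda <= n)%N ->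
  weight lambda = (\sum_(i < n) nth 0 lambda i)%N.
Proof.
move=> sl; rewrite /weight sumnE (big_nth 0%N).
rewrite -(big_mkord xpredT (fun i => nth 0%N lambda i)).
rewrite (big_cat_nat (leq0n _) sl) //= [X in _ = (_ + X)%N]big_nat_cond.
rewrite [X in _ = (_ + X)%N]big1 ?addn0 //.
by move=> i /andP[/andP[si _] _]; rewrite nth_default.
Qed.

Lemma size_le_weight (lambda : intpart) : (size lambda <= weight lambda)%N.
Proof.
rewrite (weight_sum (leqnn _)) -{1}[size _]card_ord -sum1_card.
by apply: leq_sum => i _; rewrite intpart_gt0 ltn_ord.
Qed.

(** The exponents lambda + delta, where delta = (n - 1, ..., 1, 0). *)
Definition expo n (lambda : seq nat) : 'I_n -> nat :=
  fun i => (nth 0 lambda i + (n - i.+1))%N.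

Lemma expo_decreasing n (lambda : intpart) : decreasing (@expo n lambda).
Proof.
move=> i j ij; rewrite /expo.
have := nth_sorted_geq (intpart_sorted lambda) (ltnW ij).
by have := ltn_ord j; lia.
Qed.

Lemma expo_inj n (lambda mu : intpart) :
  (size lambda <= n)%N -> (size mu <= n)%N ->
  @expo n lambda =1 @expo n mu -> lambda = mu.
Proof.
move=> sl sm e; apply: intpart_inj => i.
have [ni|ni] := ltnP i n; last by rewrite !nth_default ?(leq_trans _ ni).
by have := e (Ordinal ni); rewrite /expo /=; lia.
Qed.

Lemma decreasing_ge n (m : 'I_n -> nat) (i : 'I_n) :
  decreasing m -> (n - i.+1 <= m i)%N.
Proof.
move=> dm; case: i => i /=.
elim/ltn_ind: {i}(n - i.+1)%N {-2}i (erefl (n - i.+1)%N) => k IH i ek ni.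
case: k => [|k] in IH ek *; first by rewrite ek.
have ni' : (i.+1 < n)%N by lia.
have ek' : (n - i.+2)%N = k by lia.
have := IH k (ltnSn k) i.+1 ek' ni'.
by have := dm (Ordinal ni) (Ordinal ni') (ltnSn i); lia.
Qed.

(** Strictly decreasing exponents are of the form lambda + delta. *)
Lemma expo_surj n (m : 'I_n -> nat) : decreasing m ->
  exists2 lambda : intpart, (size lambda <= n)%N & @expo n lambda =1 m.
Proof.
move=> dm; pose f i := if insub i is Some j then (m j - (n - i.+1))%N else 0%N.
have fE (i : 'I_n) : f i = (m i - (n - i.+1))%N by rewrite /f valK.
have ss : sorted geq (mkseq f n).
  apply/(sortedP 0%N) => i; rewrite size_mkseq => ni.
  have ni' := ltnW ni; rewrite !nth_mkseq //.
  rewrite (fE (Ordinal ni)) (fE (Ordinal ni')) /=.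
  have := dm (Ordinal ni') (Ordinal ni) (ltnSn i).
  by have := decreasing_ge (Ordinal ni) dm; rewrite /=; lia.
have ip : is_intpart [seq x <- mkseq f n | x != 0%N].
  rewrite /is_intpart (sorted_filter geq_trans) //=.
  by rewrite mem_filter eqxx.
exists (IntPart ip) => /=.
  by rewrite size_filter (leq_trans (count_size _ _)) ?size_mkseq.
move=> i; rewrite /expo /= nth_filter_neq0 // nth_mkseq // fE.
by rewrite subnK // decreasing_ge.
Qed.

Lemma sort_exponents n (m : 'I_n -> nat) : injective m ->
  exists s : 'S_n, decreasing (m \o s).
Proof.
move=> im; pose t : n.-tuple nat := [tuple m i | i < n].
have /tuple_permP[s es] : perm_eq (sort_tuple geq t) t by rewrite perm_sort.
exists s => i j ij.
have E (k : 'I_n) : m (s k) = nth 0%N (sort geq t) k.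
  rewrite (es : sort geq t = _) -(tnth_nth 0%N (mktuple _)) tnth_mktuple.
  by rewrite tnth_mktuple.
rewrite /comp ltn_neqAle !E; apply/andP; split; last first.
  apply: nth_sorted_geq (ltnW ij); apply: sort_sorted => a b /=; lia.
rewrite -!E (inj_eq im) (inj_eq perm_inj); apply/eqP => e.
by rewrite e ltnn in ij.
Qed.

(** * Products of bialternants in a fixed number of variables *)

(** The alternant of delta, the denominator of the Schur polynomials. *)
Definition vandermonde n : {mpoly int[n]} :=
  alternant (fun i : 'I_n => (n - i.+1)%N).

(** The numerator of s_lambda in n variables; it is 0 when lambda has more than
    n parts. *)
Definition bialternant n (lambda : intpart) : {mpoly int[n]} :=
  if (size lambda <= n)%N then alternant (expo lambda) else 0.

(** The empty partition. *)
Definition empty_part : intpart := @IntPart [::] isT.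

Lemma vandermondeE n : vandermonde n = bialternant n empty_part.
Proof. by apply: eq_alternant => i; rewrite /expo nth_nil. Qed.

(** These coefficients make the nonzero bialternants linearly independent. *)
Lemma bialternant_coeff n (lambda mu : intpart) :
  (size mu <= n)%N ->
  (bialternant n lambda)@_(mon (expo mu)) = (lambda == mu)%:R.
Proof.
move=> sm; rewrite /bialternant; case: ifP => [sl|sl]; last first.
  by rewrite mcoeff0; case: eqP => // e; rewrite e sm in sl.
rewrite alternant_coeff; try exact: expo_decreasing.
congr (nat_of_bool _)%:R; apply/forallP/eqP => [e|-> //].
by apply: (@expo_inj n) => // i; apply/eqP.
Qed.

Lemma bialternant_neq0 n (lambda : intpart) :
  (size lambda <= n)%N -> bialternant n lambda != 0.
Proof.
move=> sl; apply/eqP => /(congr1 (mcoeff (mon (expo lambda)))).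
by rewrite bialternant_coeff // eqxx mcoeff0.
Qed.

Lemma vandermonde_neq0 n : vandermonde n != 0.
Proof. by rewrite vandermondeE bialternant_neq0. Qed.

Lemma schurE n (lambda : intpart) :
  schur n lambda = tofrac (bialternant n lambda) / tofrac (vandermonde n).
Proof.
by rewrite /schur /bialternant; case: ifP => // _; rewrite tofrac0 mul0r.
Qed.

(** c expands s_alpha s_beta in n variables, with the denominators cleared. *)
Definition expands_at n (alpha beta : intpart)
    (c : {fsfun intpart -> int with 0}) : Prop :=
  bialternant n alpha * bialternant n beta
  = vandermonde n * \sum_(mu <- finsupp c) bialternant n mu *~ c mu.

Lemma schur_expansionE n (alpha beta : intpart)
    (c : {fsfun intpart -> int with 0}) :
  schur n alpha * schur n beta = \sum_(mu <- finsupp c) (c mu)%:~R * schur n mu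
  <-> expands_at n alpha beta c.
Proof.
rewrite /expands_at.
have v0 : tofrac (vandermonde n) != 0 by rewrite tofrac_eq0 vandermonde_neq0.
have -> : \sum_(mu <- finsupp c) (c mu)%:~R * schur n mu =
    tofrac (\sum_(mu <- finsupp c) bialternant n mu *~ c mu)
    / tofrac (vandermonde n).
  rewrite raddf_sum mulr_suml; apply: eq_bigr => mu _ /=.
  by rewrite mulrzl schurE raddfMz /= mulrzAl.
rewrite !schurE mulf_div; split=> e.
  apply/eqP; move/eqP: e; rewrite eqr_div ?mulf_neq0 // mulrA (inj_eq (mulIf v0)).
  by rewrite -!tofracM tofrac_eq [vandermonde n * _]mulrC.
apply/eqP; rewrite eqr_div ?mulf_neq0 // mulrA (inj_eq (mulIf v0)).
by rewrite -!tofracM tofrac_eq e mulrC.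
Qed.

Lemma alternant_mdeg n (m : 'I_n -> nat) (e : 'X_{1..n}) :
  e \in msupp (alternant m) -> mdeg e = (\sum_i m i)%N.
Proof.
rewrite mcoeff_msupp alternant_antisym /antisym raddf_sum /= => c0.
apply/eqP; apply: contraNT c0 => ne; apply/eqP/big1 => s _.
rewrite mulr_sign.
suff c0 : (msym s 'X_[int, mon m])@_e = 0.
  by case: ifP => _; rewrite ?mcoeffN c0 ?oppr0.
rewrite mcoeff_sym mcoeffX; case: eqP => // ke.
case/eqP: ne; rewrite -(mdeg_mperm e s) -ke mdegE.
by apply: eq_bigr => i _; rewrite mnmE.
Qed.

Lemma msize_alternant n (m : 'I_n -> nat) :
  alternant m != 0 -> msize (alternant m) = (\sum_i m i)%N.+1.
Proof. by move=> m0; rewrite -mlead_deg // (alternant_mdeg (mlead_supp m0)). Qed.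

Lemma expo_sum n (lambda : intpart) : (size lambda <= n)%N ->
  (\sum_(i < n) expo lambda i = weight lambda + \sum_(i < n) (n - i.+1))%N.
Proof. by move=> sl; rewrite (weight_sum sl) -big_split. Qed.

(** The Schur polynomial as a genuine polynomial, together with its symmetry and
    a bound on its degree. *)
Lemma bialternant_quotient n (lambda : intpart) :
  exists p, [/\ bialternant n lambda = p * vandermonde n, p \is symmetric
    & forall e, e \in msupp p -> (mdeg e <= weight lambda)%N].
Proof.
rewrite /bialternant; case: ifP => sl; last first.
  by exists 0; rewrite mul0r rpred0; split=> // e; rewrite msupp0.
have [p pE] := alternant_dvd (@expo n lambda).
have v0 := vandermonde_neq0 n; exists p; split=> //.
  apply/issymP => s; apply: (mulIf v0).
  apply: (can_inj (signrMK s)).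
  by rewrite -pE mulrCA -msym_alternant -msymM -pE msym_alternant.
move=> e ep; rewrite -ltnS.
have p0 : p != 0 by apply: contraTneq ep => ->; rewrite msupp0.
have b0 := bialternant_neq0 sl; rewrite /bialternant sl in b0.
have := congr1 (fun q => msize q) pE; rewrite /= msizeM // -/(vandermonde n).
rewrite !msize_alternant // expo_sum //.
move: (msize p) (msize_mdeg_lt ep) (\sum_i _)%N => k ek S.
by move: ek; lia.
Qed.

(** An alternant vanishes if two exponents agree; otherwise sorting the exponents
    makes it a bialternant up to sign. *)
Lemma alternant_straighten n (m : 'I_n -> nat) :
  alternant m = 0 \/ exists (b : bool) (lambda : intpart),
    [/\ (size lambda <= n)%N,
       (\sum_i m i = weight lambda + \sum_(i < n) (n - i.+1))%N
      & alternant m = bialternant n lambda *~ (-1) ^+ b].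
Proof.
have [im|nim] := pselect (injective m); last first.
  left; have [|/injectivePn[i [j nij e]]] := boolP (injectiveb m).
    by move/injectiveP.
  exact: alternant_eq0 nij e.
right; have [s ds] := sort_exponents im.
have [lambda sl lE] := expo_surj ds.
exists s, lambda; split=> //.
  rewrite -expo_sum // (reindex_inj (@perm_inj _ s)).
  by apply: eq_bigr => i _; rewrite lE.
rewrite /bialternant sl (eq_alternant lE) alternant_perm.
by rewrite -mulrzl rmorphXn rmorphN1 signrMK.
Qed.

(** The expansion of s_alpha s_beta in n variables, as an unreduced list of
    coefficients and partitions.  The bound on the weights does not depend on n. *)
Lemma bialternantM n (alpha beta : intpart) :
  exists2 r : seq (int * intpart),
    (forall x, x \in r -> (size x.2 <= n)%N /\
       (weight x.2 <= weight alpha + weight beta)%N)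
  & bialternant n alpha * bialternant n beta
    = vandermonde n * \sum_(x <- r) bialternant n x.2 *~ x.1.
Proof.
have [p [-> sp dp]] := bialternant_quotient n beta.
rewrite {1}/bialternant; case: ifP => sa; last first.
  by exists [::]; rewrite ?big_nil ?mulr0 ?mul0r.
rewrite mulrA mulrC alternantM // big_seq.
pose good f := exists2 r : seq (int * intpart),
    (forall x, x \in r -> (size x.2 <= n)%N /\
       (weight x.2 <= weight alpha + weight beta)%N)
  & f = \sum_(x <- r) bialternant n x.2 *~ x.1.
suff [r gr ->] : good (\sum_(e <- msupp p | e \in msupp p)
    p@_e *: alternant (fun i => (expo alpha i + e i)%N)) by exists r.
apply: (big_ind good).
- by exists [::]; rewrite ?big_nil.
- move=> _ _ [r1 g1 ->] [r2 g2 ->]; exists (r1 ++ r2); rewrite ?big_cat //.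
  by move=> x; rewrite mem_cat => /orP[/g1|/g2].
move=> e ep.
have [->|[b [lambda [sl wl ->]]]] :=
    alternant_straighten (fun i => (expo alpha i + e i)%N).
  by exists [::]; rewrite ?big_nil ?scaler0.
exists [:: (p@_e * (-1) ^+ b, lambda)].
  move=> x; rewrite inE => /eqP-> /=; split=> //.
  move: wl; rewrite big_split /= expo_sum // -mdegE.
  move: (mdeg e) (dp e ep) (\sum_i _)%N => d dle S.
  by rewrite addnAC => /addIn <-; rewrite leq_add2l.
by rewrite big_seq1 -[X in X *: _]intz scaler_int -mulrzA mulrC.
Qed.

(** Gathering equal terms turns a list of coefficients and partitions into a
    finitely supported function. *)
Lemma fsfun_collect (r : seq (int * intpart)) :
  exists c : {fsfun intpart -> int with 0},
    (forall mu, mu \in finsupp c -> exists2 x, x \in r & mu = x.2) /\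
    forall (V : zmodType) (F : intpart -> V),
      \sum_(mu <- finsupp c) F mu *~ c mu = \sum_(x <- r) F x.2 *~ x.1.
Proof.
pose D := [fset x.2 | x in r]%fset.
pose f mu := \sum_(x <- r | x.2 == mu) x.1.
pose c : {fsfun intpart -> int with 0} := [fsfun mu in D => f mu].
have cD : (finsupp c `<=` D)%fset by apply: finsupp_sub.
exists c; split=> [mu /(fsubsetP cD)/imfsetP[x /= xr ->]|V F]; first by exists x.
transitivity (\sum_(mu <- D) F mu *~ f mu).
  rewrite (big_fset_incl _ cD) /=; last first.
    by move=> mu _; rewrite memNfinsupp => /eqP->.
  by apply: eq_fbigr => mu muD _; rewrite fsfunE muD.
under eq_bigr do rewrite /f mulrz_sumr.
rewrite (exchange_big_dep xpredT) //= big_seq [RHS]big_seq.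
apply: eq_bigr => x xr; have xD : x.2 \in D by apply/imfsetP; exists x.
rewrite -big_filter (eq_filter (a2 := pred1 x.2)); last first.
  by move=> mu; rewrite eq_sym.
by rewrite filter_pred1_uniq ?fset_uniq // big_seq1.
Qed.

(** * Changing the number of variables; existence of Schur expansions *)

(** The substitution of 0 for the last of n + 1 variables. *)
Definition set_last0 n : {mpoly int[n.+1]} -> {mpoly int[n]} :=
  comp_mpoly [tuple if unlift ord_max i is Some j then 'X_j else 0 | i < n.+1].

HB.instance Definition _ n := GRing.RMorphism.on (@set_last0 n).

Lemma set_last0X n (i : 'I_n.+1) :
  set_last0 'X_i = if unlift ord_max i is Some j then 'X_j else 0.
Proof. by rewrite /set_last0 comp_mpolyXU -tnth_nth tnth_mktuple. Qed.

Lemma set_last0_alternant n (m : 'I_n.+1 -> nat) :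
  set_last0 (alternant m)
  = \det (\matrix_(i, j) (set_last0 'X_j) ^+ m i : 'M[{mpoly int[n]}]_n.+1).
Proof.
rewrite -det_map_mx; congr (\det _); apply/matrixP => i j.
by rewrite !mxE rmorphXn.
Qed.

Lemma set_last0_alternant_gt0 n (m : 'I_n.+1 -> nat) :
  (forall i, 0 < m i)%N -> set_last0 (alternant m) = 0.
Proof.
move=> m0; rewrite set_last0_alternant (expand_det_col _ ord_max) big1 // => i _.
by rewrite mxE set_last0X unlift_none expr0n gtn_eqF // mul0r.
Qed.

Lemma set_last0_alternant_eq0 n (m : 'I_n.+1 -> nat) :
  m ord_max = 0%N -> (forall i, 0 < m (lift ord_max i))%N ->
  set_last0 (alternant m) = alternant (fun i => m (lift ord_max i)).
Proof.
move=> m0 mS; rewrite set_last0_alternant (expand_det_col _ ord_max).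
rewrite (bigD1 ord_max) //= [X in _ + X]big1 ?addr0; last first.
  move=> i; case: (unliftP ord_max i) => [j ->|->]; last by rewrite eqxx.
  by rewrite mxE set_last0X unlift_none expr0n gtn_eqF // mul0r.
rewrite mxE m0 expr0 mul1r /cofactor addnn -signr_odd odd_double mul1r.
congr (\det _); apply/matrixP => i j.
by rewrite !mxE set_last0X liftK.
Qed.

Lemma alternantS n (m : 'I_n -> nat) :
  alternant (fun i => (m i).+1) = (\prod_(j < n) 'X_j) * alternant m.
Proof.
transitivity (\det ((\matrix_(i, j) 'X_j ^+ m i) *m
   diag_mx (\row_j ('X_j : {mpoly int[n]})))).
  congr (\det _); apply/matrixP => i j; rewrite mul_mx_diag !mxE.
  by rewrite exprSr.
rewrite det_mulmx det_diag mulrC; congr (_ * _).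
by apply: eq_bigr => i _; rewrite mxE.
Qed.

Lemma set_last0_bialternant n (lambda : intpart) :
  set_last0 (bialternant n.+1 lambda)
  = (\prod_(j < n) 'X_j) * bialternant n lambda.
Proof.
rewrite /bialternant; have [sl|sl] := leqP (size lambda) n.
  rewrite leqW // set_last0_alternant_eq0 /expo.
  - rewrite -alternantS; apply: eq_alternant => i.
    by rewrite lift_max subSn ?addnS.
  - by rewrite /= subnn nth_default.
  by move=> i; rewrite addn_gt0 subn_gt0 ltnS lift_max ltn_ord orbT.
rewrite mulr0; case: ifP => [sl'|_]; last by rewrite rmorph0.
apply: set_last0_alternant_gt0 => i; rewrite /expo.
have : (0 < nth 0 lambda i)%N; last by lia.
by rewrite intpart_gt0 (leq_trans (ltn_ord i)).
Qed.

Lemma prod_mpolyX_neq0 n : \prod_(j < n) ('X_j : {mpoly int[n]}) != 0.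
Proof. by apply/prodf_neq0 => i _; rewrite -msupp_eq0 msuppX. Qed.

Lemma expands_at_pred n alpha beta c :
  expands_at n.+1 alpha beta c -> expands_at n alpha beta c.
Proof.
rewrite /expands_at => /(congr1 (@set_last0 n)).
set P := \prod_(j < n) ('X_j : {mpoly int[n]}).
have -> : set_last0 (vandermonde n.+1 *
      \sum_(mu <- finsupp c) bialternant n.+1 mu *~ c mu)
    = (P * vandermonde n) * (P * \sum_(mu <- finsupp c) bialternant n mu *~ c mu).
  rewrite rmorphM /= !vandermondeE set_last0_bialternant; congr (_ * _).
  rewrite raddf_sum mulr_sumr; apply: eq_bigr => mu _ /=.
  by rewrite raddfMz /= set_last0_bialternant mulrzAr.
rewrite rmorphM /= !set_last0_bialternant -/P.
rewrite (mulrACA P (bialternant n alpha)) (mulrACA P (vandermonde n)); apply: mulfI.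
by rewrite mulf_neq0 // prod_mpolyX_neq0.
Qed.

Lemma expands_at_le m n alpha beta c : (m <= n)%N ->
  expands_at n alpha beta c -> expands_at m alpha beta c.
Proof.
move=> /subnKC <-; elim: (n - m)%N => [|k IHk]; rewrite ?addn0 // addnS.
by move=> /expands_at_pred.
Qed.

Lemma sum_bialternant_coeff n (c : {fsfun intpart -> int with 0}) (mu : intpart) :
  (size mu <= n)%N ->
  (\sum_(nu <- finsupp c) bialternant n nu *~ c nu)@_(mon (expo mu)) = c mu.
Proof.
move=> sm; rewrite raddf_sum /=.
under eq_bigr do rewrite raddfMz /= bialternant_coeff // -mulrzl intz.
have [mc|mc] := boolP (mu \in finsupp c).
  rewrite (bigD1_seq mu) ?fset_uniq //= eqxx mulr1 big1 ?addr0 //.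
  by move=> nu /negbTE->; rewrite mulr0.
have -> : c mu = 0 by apply/eqP; rewrite -memNfinsupp.
rewrite big_seq big1 // => nu nc; case: eqP nc => [-> /(negP mc)//|_ _].
by rewrite mulr0.
Qed.

(** The coefficients of an expansion in n variables are determined on the
    partitions with at most n parts. *)
Lemma expands_at_coeff n alpha beta c f :
  expands_at n alpha beta c ->
  bialternant n alpha * bialternant n beta = vandermonde n * f ->
  forall mu : intpart, (size mu <= n)%N -> c mu = f@_(mon (expo mu)).
Proof.
move=> -> /(mulfI (vandermonde_neq0 n)) <- mu sm.
by rewrite sum_bialternant_coeff.
Qed.

Lemma schur_expansion_exists alpha beta : exists c, is_schur_expansion alpha beta c.
Proof.
pose N := (weight alpha + weight beta)%N.
(* In n variables there is an expansion all of whose terms have at most N parts. *)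
have ex n : exists2 c, expands_at n alpha beta c &
    forall mu, mu \in finsupp c -> (size mu <= minn n N)%N.
  have [r gr e] := bialternantM n alpha beta.
  have [c [cr cE]] := fsfun_collect r.
  exists c; first by rewrite /expands_at e cE.
  move=> mu /cr[x /gr[sx wx] ->]; rewrite leq_min sx.
  exact: leq_trans (size_le_weight _) wx.
have [c ec sc] := ex N; exists c => n; apply/schur_expansionE.
(* Both c and the expansion in max n N variables expand the product in N
   variables, hence coincide; the latter also expands it in n variables. *)
have [c' ec' sc'] := ex (maxn n N).
suff -> : c = c' by apply: expands_at_le ec'; rewrite leq_maxl.
apply/fsfunP => mu; have [sm|sm] := leqP (size mu) N.
  have := expands_at_le (leq_maxr n N) ec'.
  by move=> /(expands_at_coeff ec) ->; rewrite ?sum_bialternant_coeff.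
have z (d : {fsfun intpart -> int with 0}) k :
    (forall mu, mu \in finsupp d -> (size mu <= minn k N)%N) -> d mu = 0.
  move=> sd; apply/eqP; rewrite -memNfinsupp; apply: contraTN sm => /sd.
  by rewrite leq_min -leqNgt => /andP[].
by rewrite (z _ _ sc) (z _ _ sc').
Qed.

(** Littlewood-Richardson coefficients of partitions with at most n parts are
    computed in n variables. *)
Lemma LR_coeff n alpha beta f :
  bialternant n alpha * bialternant n beta = vandermonde n * f ->
  forall mu : intpart, (size mu <= n)%N -> LR alpha beta mu = f@_(mon (expo mu)).
Proof.
move=> e mu sm; rewrite /LR.
have [c cE] := schur_expansion_exists alpha beta.
have := xgetPex [fsfun]%fset (ex_intro _ c cE).
set d := xget _ _ => dE; apply: expands_at_coeff e mu sm.
exact/schur_expansionE/dE.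
Qed.

(** * Littlewood-Richardson coefficients of two-row partitions *)

Lemma two_rows_intpart q d : is_intpart [seq x <- [:: q + d; q]%N | x != 0%N].
Proof.
rewrite /is_intpart mem_filter eqxx /= andbT.
by case: q => [|q] /=; case: d => [|d] //=; lia.
Qed.

(** The partition (q + d, q). *)
Definition two_rows q d : intpart := IntPart (two_rows_intpart q d).

Lemma nth_two_rows q d i : nth 0%N (two_rows q d) i = nth 0%N [:: q + d; q]%N i.
Proof. by apply: nth_filter_neq0; rewrite /= andbT leq_addr. Qed.

Lemma size_two_rows q d : (size (two_rows q d) <= 2)%N.
Proof. by rewrite size_filter (leq_trans (count_size _ _)). Qed.

Lemma two_rowsE (lambda : intpart) : (size lambda <= 2)%N ->
  lambda = two_rows (nth 0%N lambda 1) (nth 0%N lambda 0 - nth 0%N lambda 1).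
Proof.
move=> sl; apply: intpart_inj => i; rewrite nth_two_rows.
have := nth_sorted_geq (intpart_sorted lambda) (leq0n 1).
case: i => [|[|i]] /=; try lia.
by move=> _; rewrite nth_nil nth_default // (leq_trans sl).
Qed.

Lemma weight2 (lambda : intpart) : (size lambda <= 2)%N ->
  weight lambda = (nth 0 lambda 0 + nth 0 lambda 1)%N.
Proof. by move=> sl; rewrite (weight_sum sl) !big_ord_recl big_ord0 addn0. Qed.

Lemma second_part_le_first (lambda : intpart) :
  (nth 0 lambda 1 <= nth 0 lambda 0)%N.
Proof. exact: nth_sorted_geq (intpart_sorted lambda) (leq0n 1). Qed.

(** The Clebsch-Gordan rule for the representations Sym^a and Sym^b of GL_2, with
    characters multiplied by the Weyl denominator x - y. *)
Lemma clebsch_gordan (R : comNzRingType) (x y : R) (a b : nat) : (b <= a)%N ->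
  (x ^+ a.+1 - y ^+ a.+1) * (x ^+ b.+1 - y ^+ b.+1)
  = (x - y) * \sum_(k < b.+1) (x * y) ^+ k
      * (x ^+ (a + b - k.*2).+1 - y ^+ (a + b - k.*2).+1).
Proof.
move=> ba; rewrite [X in _ * X]subrXX mulrCA; congr (_ * _).
rewrite mulrBl; under [RHS]eq_bigr do rewrite mulrBr.
rewrite sumrB !mulr_sumr; congr (_ - _).
  apply: eq_bigr => k _; rewrite exprMn mulrA -exprD mulrAC -exprD.
  by congr (x ^+ _ * _); have := ltn_ord k; lia.
rewrite (reindex_inj rev_ord_inj); apply: eq_bigr => k _ /=.
rewrite exprMn -mulrA -exprD mulrCA -exprD.
by congr (x ^+ _ * y ^+ _); have := ltn_ord k; lia.
Qed.

Lemma det_mx2 (R : comNzRingType) (M : 'M[R]_2) :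
  \det M = M ord0 ord0 * M ord_max ord_max - M ord0 ord_max * M ord_max ord0.
Proof.
rewrite (expand_det_row _ ord0) !big_ord_recl big_ord0 addr0 /cofactor !det_mx11.
rewrite !mxE expr0 expr1 mul1r mulN1r mulrN.
by congr (_ * M _ _ - M _ _ * M _ _); apply/val_inj.
Qed.

Lemma bialternant_two_rows q d (x := 'X_ord0 : {mpoly int[2]})
    (y := 'X_ord_max : {mpoly int[2]}) :
  bialternant 2 (two_rows q d) = (x * y) ^+ q * (x ^+ d.+1 - y ^+ d.+1).
Proof.
rewrite /bialternant size_two_rows /alternant det_mx2 !mxE.
rewrite /expo !nth_two_rows -/x -/y /= addn1 addn0.
by rewrite -addnS !exprD exprMn mulrBr; ring.
Qed.

Lemma bialternant_two_rowsM p a q b : (b <= a)%N ->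
  bialternant 2 (two_rows p a) * bialternant 2 (two_rows q b)
  = vandermonde 2 *
    \sum_(k < b.+1) bialternant 2 (two_rows (p + q + k) (a + b - k.*2)).
Proof.
move=> ba; have -> : vandermonde 2 = bialternant 2 (two_rows 0 0).
  by rewrite vandermondeE; congr bialternant; apply/val_inj.
rewrite !bialternant_two_rows.
set x := 'X_ord0; set y := 'X_ord_max.
under eq_bigr do rewrite bialternant_two_rows -/x -/y exprD -mulrA.
rewrite -mulr_sumr expr0 mul1r !expr1 [RHS]mulrCA -clebsch_gordan // mulrACA.
by rewrite exprD.
Qed.

(** The condition for c_{alpha, beta}^mu to be nonzero when mu has at most two
    parts. *)
Definition LR2_cond (alpha beta mu : intpart) : bool :=
  [&& (size alpha <= 2)%N, (size beta <= 2)%N,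
      (weight alpha + weight beta == weight mu)%N,
      (nth 0 alpha 1 + nth 0 beta 1 <= nth 0 mu 1)%N,
      (nth 0 mu 1 <= nth 0 alpha 0 + nth 0 beta 1)%N
    & (nth 0 mu 1 <= nth 0 alpha 1 + nth 0 beta 0)%N].

(** The partitions (p + a + b - k, p + k) are distinct, so mu matches at most one
    of them, the one with k = mu_2 - p. *)
Lemma sum_two_rows_coeff p a b (mu : intpart) :
  (b <= a)%N -> (size mu <= 2)%N ->
  (\sum_(k < b.+1) bialternant 2 (two_rows (p + k) (a + b - k.*2)))@_(mon (expo mu))
  = [&& (p <= nth 0 mu 1)%N, (nth 0 mu 1 - p <= b)%N
      & (nth 0 mu 0 + nth 0 mu 1 == p.*2 + a + b)%N]%:R.
Proof.
move=> ba sm; rewrite raddf_sum /=.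
under eq_bigr do rewrite bialternant_coeff //.
have E k : (k <= b)%N -> (two_rows (p + k) (a + b - k.*2) == mu)
    = (nth 0 mu 1 == p + k)%N && (nth 0 mu 0 + nth 0 mu 1 == p.*2 + a + b)%N.
  move=> kb; rewrite {1}[mu]two_rowsE //.
  have := second_part_le_first mu.
  move: (nth 0%N mu 0) (nth 0%N mu 1) => M1 M2 M12.
  apply/eqP/andP => [e|[/eqP e1 /eqP e2]].
    have := nth_two_rows (p + k) (a + b - k.*2) 0.
    have := nth_two_rows (p + k) (a + b - k.*2) 1.
    by rewrite e !nth_two_rows /= => e0 e1; split; apply/eqP; lia.
  by congr two_rows; lia.
case: (boolP [&& _, _ & _]) => [/and3P[h1 h2 /eqP h3]|h].
  have hk : (nth 0 mu 1 - p < b.+1)%N by lia.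
  rewrite (bigD1 (Ordinal hk)) //= E // h3 eqxx andbT subnKC // eqxx.
  rewrite [X in _ + X]big1 ?addr0 // => i ni; rewrite E; last by rewrite -ltnS.
  rewrite h3 eqxx andbT; have [e|//] := eqVneq (nth 0%N mu 1) (p + i)%N.
  by case/eqP: ni; apply/val_inj; rewrite /= e addKn.
rewrite big1 // => i _; rewrite E; last by rewrite -ltnS.
case: andP => // -[/eqP e1 e2]; case/negP: h.
by rewrite e2 e1 leq_addr addKn -ltnS ltn_ord.
Qed.

Lemma LR_sym (alpha beta mu : intpart) : LR alpha beta mu = LR beta alpha mu.
Proof.
rewrite /LR; suff -> : [set c | is_schur_expansion alpha beta c]%classic
    = [set c | is_schur_expansion beta alpha c]%classic by [].
by apply/seteqP; split=> c /= e n; rewrite mulrC e.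
Qed.

Lemma LR_two_rows (alpha beta mu : intpart) : (size mu <= 2)%N ->
  LR alpha beta mu = (LR2_cond alpha beta mu)%:R.
Proof.
move=> sm; rewrite /LR2_cond.
have [sa|sa] /= := leqP (size alpha) 2; last first.
  rewrite (@LR_coeff 2 _ _ 0) ?mcoeff0 // /bialternant.
  by rewrite leqNgt sa mul0r mulr0.
have [sb|sb] /= := leqP (size beta) 2; last first.
  rewrite (@LR_coeff 2 _ _ 0) ?mcoeff0 // /bialternant.
  by rewrite [(size beta <= _)%N]leqNgt sb !mulr0.
have ha := second_part_le_first alpha; have hb := second_part_le_first beta.
wlog ba : alpha beta sa sb ha hb /
    (nth 0 beta 0 - nth 0 beta 1 <= nth 0 alpha 0 - nth 0 alpha 1)%N.
  move=> W; have [|ab] := leqP (nth 0 beta 0 - nth 0 beta 1)%N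
    (nth 0 alpha 0 - nth 0 alpha 1)%N; first exact: W.
  rewrite LR_sym W ?(ltnW ab) //; congr (nat_of_bool _)%:R.
  by lia.
pose a := (nth 0 alpha 0 - nth 0 alpha 1)%N.
pose b := (nth 0 beta 0 - nth 0 beta 1)%N.
pose p := (nth 0 alpha 1 + nth 0 beta 1)%N.
rewrite (@LR_coeff 2 _ _ (\sum_(k < b.+1)
    bialternant 2 (two_rows (p + k) (a + b - k.*2)))) //.
  rewrite sum_two_rows_coeff // !weight2 //; congr (nat_of_bool _)%:R.
  by have := second_part_le_first mu; rewrite /p /a /b; lia.
by rewrite {1}[alpha]two_rowsE // {1}[beta]two_rowsE // bialternant_two_rowsM.
Qed.

(** * Newell-Littlewood numbers of two-row partitions *)

(** Enclosing P in a finite list s rules out an infinite support, for which the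
    sum would be 0 by convention. *)
Lemma fsum_bool_gt0 (T : choiceType) (P : pred T) (s : seq T) :
  (forall t, P t -> t \in s) ->
  0 < \sum_(t \in [set: T]%classic) ((P t)%:R : int) <-> exists t, P t.
Proof.
move=> Ps; split=> [/(fsumr_gt0 s)[t _]|[t Pt]].
  by case: (boolP (P t)) => [Pt _|_]; [exists t | rewrite ltxx].
rewrite (fsbigTE [fset t in s]%fset) => [|u]; last first.
  by rewrite !inE; case: (boolP (P u)) => // /Ps ->.
rewrite (bigD1_seq t) ?fset_uniq ?inE ?Ps //= Pt.
by rewrite ltr_pwDl // sumr_ge0 // => u _; case: (P u).
Qed.

(** The condition for the term of the triple t = (alpha, beta, gamma) to be
    nonzero. *)
Definition NL2_cond (mu nu lambda : intpart) (t : intpart * intpart * intpart) :=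
  [&& LR2_cond t.1.1 t.1.2 mu, LR2_cond t.1.1 t.2 nu & LR2_cond t.1.2 t.2 lambda].

Lemma newell_littlewood_gt0 (mu nu lambda : intpart) :
  (size mu <= 2)%N -> (size nu <= 2)%N -> (size lambda <= 2)%N ->
  0 < newell_littlewood mu nu lambda <-> exists t, NL2_cond mu nu lambda t.
Proof.
move=> sm sn sl.
have [s sP] : exists s : seq intpart, forall x : intpart,
    (size x <= 2)%N -> (weight x <= weight mu + weight nu)%N -> x \in s.
  pose w := (weight mu + weight nu).+1.
  exists [seq two_rows q d | q <- iota 0 w, d <- iota 0 w] => x sx wx.
  rewrite [x]two_rowsE //; apply/allpairsP.
  exists (nth 0%N x 1, (nth 0%N x 0 - nth 0%N x 1)%N); split=> //.
    by rewrite mem_iota /= add0n; move: wx; rewrite weight2 // /w; lia.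
  by rewrite mem_iota /= add0n; move: wx; rewrite weight2 // /w; lia.
have -> : newell_littlewood mu nu lambda =
    \sum_(t \in [set: intpart * intpart * intpart]%classic)
      ((NL2_cond mu nu lambda t)%:R : int).
  apply: eq_fsbigr => -[[alpha beta] gamma] _; rewrite !LR_two_rows //.
  by rewrite -!natrM !mulnb /NL2_cond andbA.
apply: (fsum_bool_gt0
  (s := [seq (x, z) | x <- [seq (x, y) | x <- s, y <- s], z <- s])).
move=> [[alpha beta] gamma] /and3P[/= c1 c2 _].
move: c1 c2 => /and4P[sa sb /eqP wm _] /and4P[_ sc /eqP wn _].
have [sA sB sC] : [/\ alpha \in s, beta \in s & gamma \in s].
  by split; apply: sP => //; lia.
apply/allpairsP; exists ((alpha, beta), gamma); split=> //.
by apply/allpairsP; exists (alpha, beta).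
Qed.

(** * Solving the linear conditions *)

Lemma seq_max (l : int) (s : seq int) :
  exists2 x, x \in l :: s & all (fun y => y <= x) (l :: s).
Proof.
elim: s l => [|k s IHs] l; first by exists l; rewrite ?inE //= lexx.
have [x xs mx] := IHs k; have [xl|lx] := leP x l.
  exists l; first by rewrite inE eqxx.
  by rewrite /= lexx; apply: sub_all mx => y /le_trans; apply.
exists x; first by rewrite inE xs orbT.
by move: mx; rewrite /= (ltW lx).
Qed.

(** A, B, C stand for |alpha|, |beta|, |gamma| and x, y, z for alpha_2, beta_2,
    gamma_2.  Each unknown in turn is taken to be the greatest of its lower
    bounds; those for x are what remains after eliminating z and then y. *)
Lemma newell_littlewood_feasible (l1 l2 m1 m2 n1 n2 A B C : int) :
  0 <= l2 -> l2 <= l1 -> 0 <= m2 -> m2 <= m1 -> 0 <= n2 -> n2 <= n1 ->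
  0 <= A -> 0 <= B -> 0 <= C ->
  A + B = m1 + m2 -> A + C = n1 + n2 -> B + C = l1 + l2 ->
  [/\ [/\ l1 <= m1 + n1, n1 <= l1 + m1 & m1 <= l1 + n1],
      [/\ l2 <= m1 + n2, n2 <= l1 + m2 & m2 <= l1 + n2],
      [/\ l2 <= m2 + n1, n2 <= l2 + m1 & m2 <= l2 + n1],
      [/\ n1 - n2 <= m1 + m2 + l1 - l2,
          m1 - m2 <= l1 + l2 + n1 - n2
        & l1 - l2 <= n1 + n2 + m1 - m2]
    & [/\ l1 - l2 <= m1 + m2 + n1 - n2,
          m1 - m2 <= n1 + n2 + l1 - l2
        & n1 - n2 <= l1 + l2 + m1 - m2]] ->
  exists x y z : int,
  [/\ [/\ 0 <= x, 0 <= y & 0 <= z],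
      [/\ x *+ 2 <= A, y *+ 2 <= B & z *+ 2 <= C],
      [/\ x + y <= m2, m2 <= A - x + y & m2 <= x + (B - y)],
      [/\ x + z <= n2, n2 <= A - x + z & n2 <= x + (C - z)]
    & [/\ y + z <= l2, l2 <= B - y + z & l2 <= y + (C - z)]].
Proof.
move=> hl2 hl hm2 hm hn2 hn hA hB hC eAB eAC eBC.
move=> [[i1 i2 i3] [i4 i5 i6] [i7 i8 i9] [i10 i11 i12] [i13 i14 i15]].
(* The lower bounds for x are 0 and those that n2 <= x + (C - z) and
   m2 <= x + (B - y) imply, given that y is at least 0 and l2 - C, and z at
   least 0 and y - B + l2. *)
have [x xs xm] :=
  seq_max 0 [:: n2 - C; m2 - B; l2 + n2 - B - C; l2 - C - B + m2;
    l2 + l2 + n2 - B - C - C].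
rewrite !inE in xs; move: xm => /and5P[x1 x2 x3 x4 /and3P[x5 x6 _]].
(* These facts about x say that each lower bound for y or z is at most each of
   their upper bounds; the facts about y below do the same for z. *)
have [] : [/\ x <= n2, x + x <= A, x + x <= A - n2 + A - n2 + C, x <= m2 &
             x <= A + l2 - n2].
  by do 5?[case/orP: xs => xs]; move/eqP: xs => ->; split; lia.
move=> X1 X2 X3 X4 X5.
have [] : [/\ x <= B + n2 - l2, x + l2 - C <= m2, x + l2 - C <= A + l2 - n2,
              x + l2 - C <= B + n2 - l2 & x <= l2 + A - m2].
  by do 5?[case/orP: xs => xs]; move/eqP: xs => ->; split; lia.
move=> X6 X7 X8 X9 X10.
have [] : [/\ x <= A + C - n2, (x - A + m2) *+ 2 <= B,
   (x - A - C + n2 + l2) *+ 2 <= B, (x - A + m2) *+ 2 <= B + B - l2 - l2 + C &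
   (x - A - C + n2 + l2) *+ 2 <= B + B - l2 - l2 + C].
  by do 5?[case/orP: xs => xs]; move/eqP: xs => ->; split; lia.
move=> X11 X12 X13 X14 X15.
have [] : [/\ x + x - A + m2 <= m2, x + x - A + m2 <= A + l2 - n2 &
   x + x - A + m2 <= B + n2 - l2].
  by do 5?[case/orP: xs => xs]; move/eqP: xs => ->; split; lia.
move=> X16 X17 X18.
have [] : [/\ x + x - A - C + n2 + l2 <= m2,
   x + x - A - C + n2 + l2 <= A + l2 - n2 &
   x + x - A - C + n2 + l2 <= B + n2 - l2].
  by do 5?[case/orP: xs => xs]; move/eqP: xs => ->; split; lia.
move=> X19 X20 X21 {xs}.
have [y] := seq_max 0 [:: l2 - C; x - A + m2; x - A - C + n2 + l2].
rewrite !inE => ys /and5P[y1 y2 y3 y4 _].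
have [] : [/\ y <= l2, x + y <= m2, x + y <= A + l2 - n2 & x + y <= B + n2 - l2].
  by do 3?[case/orP: ys => ys]; move/eqP: ys => ->; split; lia.
move=> Y1 Y2 Y3 Y4.
have [] : [/\ y - x <= B - m2, y - x <= B + C - l2 - n2, y *+ 2 <= B &
   y *+ 2 <= B + B - l2 - l2 + C].
  by do 3?[case/orP: ys => ys]; move/eqP: ys => ->; split; lia.
move=> Y5 Y6 Y7 Y8 {ys}.
have [z] := seq_max 0 [:: x - A + n2; y - B + l2].
rewrite !inE => zs /and4P[z1 z2 z3 _]; exists x, y, z.
by do 2?[case/orP: zs => zs]; move/eqP: zs => zs; split; split; lia.
Qed.

Theorem theorem5p14 (lambda mu nu : intpart)
    (hlambda : (size lambda <= 2)%N)
    (hmu : (size mu <= 2)%N)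
    (hnu : (size nu <= 2)%N)
    (hparity : (weight lambda + weight mu + weight nu)%N = 0%N %[mod 2])
    (htri1 : (weight lambda <= weight mu + weight nu)%N)
    (htri2 : (weight nu <= weight mu + weight lambda)%N)
    (htri3 : (weight mu <= weight lambda + weight nu)%N) :
  let l1 := part lambda 1 in let l2 := part lambda 2 in
  let m1 := part mu 1 in let m2 := part mu 2 in
  let n1 := part nu 1 in let n2 := part nu 2 in
  0 < newell_littlewood mu nu lambda <->
  [/\ [/\ l1 <= m1 + n1, n1 <= l1 + m1 & m1 <= l1 + n1],
      [/\ l2 <= m1 + n2, n2 <= l1 + m2 & m2 <= l1 + n2],
      [/\ l2 <= m2 + n1, n2 <= l2 + m1 & m2 <= l2 + n1],
      [/\ n1 - n2 <= m1 + m2 + l1 - l2,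
          m1 - m2 <= l1 + l2 + n1 - n2
        & l1 - l2 <= n1 + n2 + m1 - m2]
    & [/\ l1 - l2 <= m1 + m2 + n1 - n2,
          m1 - m2 <= n1 + n2 + l1 - l2
        & n1 - n2 <= l1 + l2 + m1 - m2]].
Proof.
rewrite /part /=; move: hparity htri1 htri2 htri3.
rewrite newell_littlewood_gt0 // !weight2 //.
have := second_part_le_first nu; have := second_part_le_first mu.
have := second_part_le_first lambda.
have mE := weight2 hmu; have nE := weight2 hnu; have lE := weight2 hlambda.
move=> l12 m12 n12 hpar h1 h2 h3; split.
  move=> [[[alpha beta] gamma]] /and3P[/= c1 c2 c3].
  have /and5P[sa sb wm i1 /andP[i2 i3]] := c1.
  have /and5P[_ sc wn i4 /andP[i5 i6]] := c2.
  have /and5P[_ _ wl i7 /andP[i8 i9]] := c3.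
  move: wm wn wl i1 i2 i3 i4 i5 i6 i7 i8 i9
    (second_part_le_first alpha) (second_part_le_first beta)
    (second_part_le_first gamma).
  rewrite !weight2 // {c1 c2 c3 mE nE lE}.
  move: l12 m12 n12 hpar h1 h2 h3.
  move: (nth 0%N lambda 0) (nth 0%N lambda 1) (nth 0%N mu 0) (nth 0%N mu 1)
   (nth 0%N nu 0) (nth 0%N nu 1) => l1 l2 m1 m2 n1 n2.
  move: (nth 0%N alpha 0) (nth 0%N alpha 1) (nth 0%N beta 0) (nth 0%N beta 1)
   (nth 0%N gamma 0) (nth 0%N gamma 1) => a1 a2 b1 b2 c1 c2.
  by move=> *; split; split; lia.
(* The weights of alpha, beta and gamma are forced by |alpha| + |beta| = |mu|,
   |alpha| + |gamma| = |nu| and |beta| + |gamma| = |lambda|; the parity hypothesis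
   makes the halves exact and the triangle inequalities make them nonnegative. *)
pose half p q r := ((p + q - r) %/ 2)%N.
pose A := half (weight mu) (weight nu) (weight lambda).
pose B := half (weight mu) (weight lambda) (weight nu).
pose C := half (weight lambda) (weight nu) (weight mu).
have [eAB eAC eBC] : [/\ A + B = weight mu, A + C = weight nu
    & B + C = weight lambda]%N.
  by rewrite /A /B /C /half mE nE lE; split; lia.
case/(@newell_littlewood_feasible _ _ _ _ _ _ A B C); try lia.
move=> x [y [z [[x0 y0 z0] [xA yB zC] [i1 i2 i3] [i4 i5 i6] [i7 i8 i9]]]].
exists (two_rows `|x|%N (A - `|x|%N.*2), two_rows `|y|%N (B - `|y|%N.*2),
  two_rows `|z|%N (C - `|z|%N.*2)).
rewrite /NL2_cond /LR2_cond !size_two_rows !weight2 ?size_two_rows //.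
rewrite !nth_two_rows /=.
by apply/and3P; split; apply/and4P; split; lia.
Qed.
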